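(* The modular inverse function $\mathrm{inv}(m,n)$ (for coprime integer arguments $n\ge2$ and $m\in\{1,\dots,n-1\}$) can be represented by the arithmetic term $$\mathrm{HW}(M(m,n))/(n+5)-(n+1)^4,$$ i.e. $\mathrm{inv}(m,n)$ equals this expression for all such $m,n$, where $$\begin{aligned}M(m,n)={}&\mathcal C(2,4)+\mathcal A((m^2+1)x_1^2,4)+\mathcal A(-2mnx_1x_2,4)+\mathcal A(-2x_1x_3,4)\\&+\mathcal A(-2(m+1)x_1,4)+\mathcal A(2x_3x_4,4)+\mathcal A(-2x_1x_4,4)\\&+\mathcal A(n^2x_2^2,4)+\mathcal A(2x_3,4)+\mathcal A(x_3^2,4)\\&+\mathcal A(2nx_2,4)+\mathcal A(2x_4,4)+\mathcal A(x_4^2,4),\end{aligned}$$ with $\mathcal C$ and $\mathcal A$ formed with the parameters $t=n+1$ and $w=n+5$.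
   Context: For coprime integers $n\ge2$ and $m\in\{1,\dots,n-1\}$, $\mathrm{inv}(m,n)$ is the unique $x\in\{1,\dots,n-1\}$ with $mx\equiv1\pmod n$. $\mathrm{HW}(N)$ is the Hamming weight of $N$ (number of ones in its binary representation). $G_r(q,s)=\sum_{j=0}^{s}j^rq^j$ with $0^0=1$; for each fixed $r$ this has a closed form. Given parameters $t>1$, $w$ (depending on the arguments) and $k\ge1$: $$\mathcal C(\varepsilon,k)=(2^w-\varepsilon+1)\,\frac{2^{2wt^k}-1}{2^w+1},$$ and for a monomial $\mu=\alpha\, b_1^{\beta_1x_1}\cdots b_k^{\beta_kx_k}x_1^{\gamma_1}\cdots x_k^{\gamma_k}$ in the formal variables $x_1,\dots,x_k$ (with $\alpha$ an integer possibly negative, and absent exponential factors meaning $\beta_i=0$, absent powers meaning $\gamma_i=0$), $$\mathcal A(\mu,k)=-(2^w-1)\,\alpha\prod_{i=1}^kG_{\gamma_i}\!\left(2^{2wt^{i-1}}b_i^{\beta_i},\,t-1\right).$$ An arithmetic term is an expression built from natural-number constants and the variables by the operations $x+y$, $\max(x-y,0)$, $\lfloor x/y\rfloor$, $x^y$ (with $0^0=1$, $\lfloor x/0\rfloor=0$). Products, $\mathrm{HW}$ and $G_r$ (fixed $r$) are expressible by arithmetic terms and are used as abbreviations; formulas are written with ordinary subtraction and exact division for readability. *)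

(* Defs.v *)
From mathcomp Require Import all_boot all_order all_algebra.

Set Implicit Arguments.
Unset Strict Implicit.
Unset Printing Implicit Defensive.

Import Order.TTheory GRing.Theory Num.Theory.

Local Open Scope ring_scope.

(* The value outside the coprime case is irrelevant; [modinv_spec] and [modinv_uniq]
   show that this is the unique inverse in {1, ..., n-1}. *)
Definition modinv (m n : nat) : nat :=
  head 0%N [seq x <- iota 1 n.-1 | (m * x == 1 %[mod n])%N].

Lemma modinv_spec (m n : nat) : (1 < n)%N -> coprime m n ->
  (1 <= modinv m n <= n - 1)%N /\ (m * modinv m n = 1 %[mod n])%N.
Proof.
move=> n_gt1 co_mn; rewrite /modinv.
set s := filter _ _.
suff: head 0%N s \in s.
  rewrite {2}/s mem_filter mem_iota => /andP[/eqP-> /andP[-> /=]].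
  by rewrite add1n ltnS subn1.
suff: exists x, x \in s by case: s => [[] | y s _] //=; rewrite mem_head.
exists (chinese m n 0 1 %/ m %% n)%N; rewrite mem_filter.
have m_gt0 : (0 < m)%N.
  by case: m co_mn {s} => //; rewrite /coprime gcd0n => /eqP n1; rewrite n1 in n_gt1.
have /dvdnP[k Dk] : (m %| chinese m n 0 1)%N.
  by rewrite /dvdn (chinese_modl co_mn) mod0n.
have: (k * m = 1 %[mod n])%N by rewrite -Dk (chinese_modr co_mn).
rewrite Dk mulnK // modnMmr mulnC => mk1.
rewrite mk1 eqxx mem_iota add1n prednK ?(ltnW n_gt1) // ltn_mod (ltnW n_gt1) andbT /=.
rewrite lt0n; apply: contra_eq_neq mk1 => k0.
by rewrite -modnMmr k0 muln0 mod0n modn_small.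
Qed.

Lemma modinv_uniq (m n x : nat) : (1 < n)%N -> coprime m n ->
  (1 <= x <= n - 1)%N -> (m * x = 1 %[mod n])%N -> x = modinv m n.
Proof.
move=> n_gt1 co_mn x_int mx1; have [y_int my1] := modinv_spec n_gt1 co_mn.
have small z : (1 <= z <= n - 1)%N -> (z < n)%N.
  by case/andP=> _ z_le; rewrite (leq_ltn_trans z_le) // subn1 ltn_predL ltnW.
have E : (x = modinv m n %[mod n])%N.
  rewrite -[in LHS](muln1 x) -modnMmr -my1 modnMmr mulnA (mulnC x).
  by rewrite -modnMml mx1 modnMml mul1n.
by move: E; rewrite !modn_small ?small.
Qed.

(* The bits of N of index >= N vanish, since N < 2 ^ N. *)
Definition HW (N : nat) : nat := (\sum_(0 <= i < N) odd (N %/ 2 ^ i))%N.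

Definition G (r : nat) (q : int) (s : nat) : int :=
  \sum_(0 <= j < s.+1) j%:Z ^+ r * q ^+ j.

(* The monomial
     alpha * b_1^(beta_1 x_1) ... b_k^(beta_k x_k) * x_1^gamma_1 ... x_k^gamma_k
   in the formal variables x_1, ..., x_k; the index x_i is (i - 1 : 'I_k). *)
Record monomial (k : nat) := Monomial {
  mcoef : int;
  mbase : 'I_k -> nat;
  mbeta : 'I_k -> nat;
  mgamma : 'I_k -> nat
}.

(* alpha * x_1^g_1 ... x_k^g_k, without exponential factors (beta_i = 0). *)
Definition pmonomial (k : nat) (alpha : int) (g : k.-tuple nat) : monomial k :=
  Monomial alpha (fun=> 1%N) (fun=> 0%N) (tnth g).

(* The division is exact, see [dvdz_calC]. *)
Definition calC (t w : nat) (eps : int) (k : nat) : int :=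
  (2 ^+ w - eps + 1) * ((2 ^+ (2 * w * t ^ k) - 1) %/ (2 ^+ w + 1))%Z.

Lemma dvdz_calC (t w k : nat) :
  ((2 ^+ w + 1 : int) %| 2 ^+ (2 * w * t ^ k) - 1)%Z.
Proof.
rewrite (mulnC 2%N w) exprM subrX1 dvdz_mulr // exprM subr_sqr_1.
exact: dvdz_mull.
Qed.

(* With i : 'I_k counted from 0, the exponent t ^ (i - 1) becomes t ^ i. *)
Definition calA (t w k : nat) (mu : monomial k) : int :=
  - (2 ^+ w - 1) * mcoef mu *
  \prod_(i < k)
     G (mgamma mu i) (2 ^+ (2 * w * t ^ i) * (mbase mu i)%:Z ^+ mbeta mu i) t.-1.

Definition M (m n : nat) : int :=
  let C := calC n.+1 (n + 5) in
  let A (alpha : int) (g : 4.-tuple nat) := calA n.+1 (n + 5) (pmonomial alpha g) in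
  C 2 4
  + A (m%:Z ^+ 2 + 1)   [tuple 2; 0; 0; 0]%N
  + A (- 2 * m%:Z * n%:Z) [tuple 1; 1; 0; 0]%N
  + A (- 2)             [tuple 1; 0; 1; 0]%N
  + A (- 2 * (m%:Z + 1)) [tuple 1; 0; 0; 0]%N
  + A 2                 [tuple 0; 0; 1; 1]%N
  + A (- 2)             [tuple 1; 0; 0; 1]%N
  + A (n%:Z ^+ 2)       [tuple 0; 2; 0; 0]%N
  + A 2                 [tuple 0; 0; 1; 0]%N
  + A 1                 [tuple 0; 0; 2; 0]%N
  + A (2 * n%:Z)        [tuple 0; 1; 0; 0]%N
  + A 2                 [tuple 0; 0; 0; 1]%N
  + A 1                 [tuple 0; 0; 0; 2]%N.

Inductive aterm (k : nat) : Type :=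
  | AConst of nat
  | AVar of 'I_k
  | AAdd of aterm k & aterm k
  | AMonus of aterm k & aterm k
  | ADiv of aterm k & aterm k
  | APow of aterm k & aterm k.

Arguments AConst {k}.

(* On nat, subn is truncated, x %/ 0 = 0 and 0 ^ 0 = 1. *)
Fixpoint aeval (k : nat) (e : k.-tuple nat) (T : aterm k) : nat :=
  match T with
  | AConst c => c
  | AVar i => tnth e i
  | AAdd T1 T2 => (aeval e T1 + aeval e T2)%N
  | AMonus T1 T2 => (aeval e T1 - aeval e T2)%N
  | ADiv T1 T2 => (aeval e T1 %/ aeval e T2)%N
  | APow T1 T2 => (aeval e T1 ^ aeval e T2)%N
  end.

Fixpoint asubst (k l : nat) (s : 'I_k -> aterm l) (T : aterm k) : aterm l :=
  match T with
  | AConst c => AConst c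
  | AVar i => s i
  | AAdd T1 T2 => AAdd (asubst s T1) (asubst s T2)
  | AMonus T1 T2 => AMonus (asubst s T1) (asubst s T2)
  | ADiv T1 T2 => ADiv (asubst s T1) (asubst s T2)
  | APow T1 T2 => APow (asubst s T1) (asubst s T2)
  end.

(* The term HW(M) / (n + 5) - (n + 1) ^ 4 in the variables m, n (of index 0
   and 1), given a term HWt in one variable for HW and a term Mt for M. *)
Definition modinv_term (HWt : aterm 1) (Mt : aterm 2) : aterm 2 :=
  let n := AVar (lift ord0 ord0 : 'I_2) in
  AMonus (ADiv (asubst (fun=> Mt) HWt) (AAdd n (AConst 5)))
         (APow (AAdd n (AConst 1)) (AConst 4)).

(* Main.v *)
Require Import Defs.
From mathcomp Require Import all_boot all_order all_algebra.
From mathcomp Require Import zify ring.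

(** Let P(x) = (m x1 - n x2 - 1)^2 + (x1 - x3 - x4 - 1)^2 and consider its zeros
    in the cube {0, ..., n}^4. The first square vanishes only for
    x1 = inv(m, n), with one value of x2, and then the second one leaves the
    inv(m, n) pairs (x3, x4) of sum inv(m, n) - 1. So P has exactly inv(m, n)
    zeros in the cube ([card_inv_poly_eq0]).

    Put t = n + 1 and w = n + 5. A product of sums G over the four variables is
    a sum over the points of the cube, where x has its own place
    x1 + t x2 + t^2 x3 + t^3 x4 in base 2^(2w). The formula defining M is
    arranged so that the digit of M at the place of x is
    (2^w - 1) (2^w + 1 - P(x)) ([M_sum]). As 0 <= P(x) <= 2^w, this digit does
    not overflow: it is 2^(2w) - 1, of Hamming weight 2w, when P(x) = 0, and
    otherwise it is c (2^w - 1) with 1 <= c <= 2^w, which always has weight w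
    ([HW_mul_pred_expn]). Summing over the cube, HW(M) = w (t^4 + inv(m, n))
    ([HW_M]), which is the formula.

    That HW and M are arithmetic terms rests on reading numbers off as digits of
    quantities with a closed form. By Legendre's formula, HW(N) is the exponent
    of 2 in the central binomial coefficient of 2N ([logn_central_bin]).
    Binomial coefficients are digits of a power of 1 + B, a gcd counts lattice
    points on a segment and is a digit of a product of two geometric sums
    ([arith_gcd]), and the exponent of a power of 2 is extracted by the
    congruence (1 + y)^v = 1 + v y modulo y^2 ([arith_log2]). For M, the sums G
    satisfy a recurrence in r that uses the four operations only ([G_rec]), and
    signs are handled by working with differences of two terms. *)

Set Implicit Arguments.
Unset Strict Implicit.
Unset Printing Implicit Defensive.

(** * Digits in base B *)

Lemma digits_lt (B n : nat) (d : nat -> nat) :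
  (forall i, i < n -> d i < B) -> \sum_(i < n) d i * B ^ i < B ^ n.
Proof.
elim: n => [|n IHn] d_lt; first by rewrite big_ord0 expn0.
rewrite big_ord_recr /= expnS.
have IH := IHn (fun i lt_in => d_lt i (ltnW lt_in)).
rewrite (@leq_trans ((d n).+1 * B ^ n)) ?leq_mul2r ?d_lt ?orbT //.
by rewrite mulSn ltn_add2r.
Qed.

(** The terms above place k add a multiple of B^(k+1) and those below it add less
    than B^k, so that the quotient is congruent to the digit d k modulo B. *)
Lemma digit_extract (B n k : nat) (d : nat -> nat) :
  (forall i, i < n -> d i < B) -> k < n ->
  (\sum_(i < n) d i * B ^ i) %/ B ^ k %% B = d k.
Proof.
move=> d_lt lt_kn.
have B_gt0 : 0 < B by apply: leq_ltn_trans (d_lt k lt_kn).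
rewrite -(big_mkord xpredT (fun i => d i * B ^ i)).
rewrite (@big_cat_nat _ _ _ k.+1) //= big_nat_recr //= big_mkord.
have Dhi : \sum_(k.+1 <= i < n) d i * B ^ i =
           B ^ k.+1 * \sum_(k.+1 <= i < n) d i * B ^ (i - k.+1).
  rewrite big_distrr /=; apply: eq_big_nat => i /andP[lt_ki _].
  by rewrite [RHS]mulnCA -expnD subnKC.
have Dsum X S : S + (d k * B ^ k) + B ^ k.+1 * X = S + (X * B + d k) * B ^ k.
  by rewrite expnS; ring.
rewrite Dhi Dsum.
rewrite divnDMl ?expn_gt0 ?B_gt0 // divn_small ?add0n ?modnMDl ?modn_small ?d_lt //.
by apply: digits_lt => i /ltn_trans lt_ik; apply/d_lt/lt_ik.
Qed.

Definition place (t k : nat) (f : {ffun 'I_k -> 'I_t}) : nat :=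
  \sum_(i < k) f i * t ^ i.

(** The entries of f are the base t digits of its place. *)
Lemma place_inj (t k : nat) : injective (@place t k).
Proof.
rewrite /place => f g /= eq_fg; apply/ffunP => i; apply/val_inj => /=.
have Ext (h : {ffun 'I_k -> 'I_t}) :
    (\sum_(i < k) h i * t ^ i) %/ t ^ i %% t = h i.
  have t_gt0 : 0 < t by case: (t) (h i) => [[]|].
  (* The entries of h are extended by 0 to a function on all of nat. *)
  have := @digit_extract t k i (fun j => oapp (fun j => h j : nat) 0 (insub j)).
  under eq_bigr => j _ do rewrite valK /=.
  by rewrite valK => -> // j _; case: insub => /=.
by rewrite -Ext eq_fg Ext.
Qed.

Section FiniteFamily.
Variables (I : finType) (pos : I -> nat).

(** Grouping the summands by their place turns a sum over any finite family into
    a positional expansion, provided the grouped coefficients stay below B. *)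
Lemma sum_by_position (B : nat) (d : I -> nat) :
  \sum_i d i * B ^ pos i =
  \sum_(j < (\max_i pos i).+1) (\sum_(i | pos i == j) d i) * B ^ j.
Proof.
rewrite (partition_big (fun i => inord (pos i) : 'I_(\max_i pos i).+1) xpredT) //=.
have pos_lt i : pos i < (\max_i pos i).+1 by rewrite ltnS leq_bigmax.
apply: eq_bigr => j _; rewrite big_distrl /=.
have E i : (inord (pos i) == j) = (pos i == j).
  by rewrite -val_eqE /= inordK.
by under eq_bigl => i do rewrite E; apply: eq_bigr => i /eqP ->.
Qed.

(** This reads a cardinality off a single number: with fewer than B summands no
    digit of the sum can overflow, so the digit at place k counts the i at k. *)
Lemma count_by_digit (B k : nat) : #|I| < B ->
  (\sum_i B ^ pos i) %/ B ^ k %% B = #|[pred i | pos i == k]|.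
Proof.
move=> card_lt.
have Dsum : \sum_i B ^ pos i = \sum_i 1 * B ^ pos i.
  by under [RHS]eq_bigr => i _ do rewrite mul1n.
have card_le j : \sum_(i | pos i == j) 1 < B.
  by rewrite sum1_card (leq_ltn_trans _ card_lt) // max_card.
rewrite Dsum sum_by_position; case: (ltnP k (\max_i pos i).+1) => [lt_k|ge_k].
  by rewrite (@digit_extract _ _ _ (fun j => \sum_(i | pos i == j) 1)) ?sum1_card.
have B_gt0 : 0 < B by apply: leq_ltn_trans card_lt.
rewrite divn_small ?mod0n.
  apply/esym/eq_card0 => i; rewrite !inE; apply/eqP => Dk.
  by have := leq_bigmax (F := pos) i; rewrite Dk leqNgt ge_k.
apply: leq_trans (leq_pexp2l B_gt0 ge_k).
by apply: (@digits_lt _ _ (fun j => \sum_(i | pos i == j) 1)).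
Qed.
End FiniteFamily.

(** * Hamming weight *)

(** The defining sum may be cut or extended to any range that covers all the bits. *)
Lemma HW_bits (K N : nat) : N < 2 ^ K -> HW N = \sum_(i < K) odd (N %/ 2 ^ i).
Proof.
have vanish a b : N < 2 ^ a -> \sum_(a <= i < b) odd (N %/ 2 ^ i) = 0.
  move=> lt_Na; rewrite big_nat big1 // => i /andP[le_ai _].
  by rewrite divn_small // (leq_trans lt_Na) // leq_exp2l.
move=> lt_NK; rewrite /HW -(big_mkord xpredT (fun i => odd (N %/ 2 ^ i) : nat)).
case: (leqP N K) => [le_NK | /ltnW le_KN].
  by rewrite [RHS](big_cat_nat _ le_NK) //=
             (vanish N K (ltn_expl N (ltnSn 1))) addn0.
by rewrite (big_cat_nat _ le_KN) //= (vanish K N lt_NK) addn0.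
Qed.

(** The binary expansions of a and b * 2^K do not overlap. *)
Lemma HW_cat (K a b : nat) : a < 2 ^ K -> HW (a + b * 2 ^ K) = HW a + HW b.
Proof.
move=> lt_aK; have lt_b := ltn_expl b (ltnSn 1).
rewrite (@HW_bits (K + b)); last first.
  rewrite expnD [2 ^ K * _]mulnC (@leq_trans (b.+1 * 2 ^ K)) //.
    by rewrite mulSn ltn_add2r.
  by rewrite leq_mul2r lt_b orbT.
rewrite (HW_bits lt_aK) (HW_bits lt_b) big_split_ord /=; congr (_ + _).
  apply: eq_bigr => i _; have le_iK : i <= K by apply: ltnW.
  (* Dividing by 2^i with i < K leaves the even summand b * 2^(K - i). *)
  have -> : 2 ^ K = 2 ^ (K - i) * 2 ^ i by rewrite -expnD subnK.
  rewrite mulnA divnDMl ?expn_gt0 //.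
  by rewrite oddD oddM oddX subn_eq0 leqNgt ltn_ord /= andbF addbF.
apply: eq_bigr => i _; rewrite expnD divnMA divnDMl ?expn_gt0 //.
by rewrite (divn_small lt_aK).
Qed.

Lemma HW0 : HW 0 = 0.
Proof. by rewrite /HW big_geq. Qed.

Lemma HW_odd_double (b : bool) (N : nat) : HW (b + N.*2) = b + HW N.
Proof.
rewrite -muln2 -(expn1 2) HW_cat; last by case: b.
by congr (_ + _); case: b; rewrite /HW ?big_nat1 ?big_geq // divn1.
Qed.

(** Subtracting from 2^w - 1 causes no borrow: it flips each of the w bits. *)
Lemma HW_complement (w c : nat) : c < 2 ^ w -> HW c + HW (2 ^ w - 1 - c) = w.
Proof.
elim: w c => [|w IHw] c; first by case: c => // _; rewrite HW0.
rewrite expnS mul2n => lt_c.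
have lt_h : c./2 < 2 ^ w by rewrite ltn_half_double.
have -> : (2 ^ w).*2 - 1 - c = (~~ odd c) + (2 ^ w - 1 - c./2).*2.
  by have := odd_double_half c; case: odd => /=; lia.
rewrite -{1}[c]odd_double_half !HW_odd_double addnACA IHw //.
by case: odd.
Qed.

(** One has (2^w - 1) c = (c - 1) 2^w + (2^w - 1 - (c - 1)): the upper and the
    lower w bits are complementary, whatever c is. *)
Lemma HW_mul_pred_expn (w c : nat) :
  0 < c <= 2 ^ w -> HW ((2 ^ w - 1) * c) = w.
Proof.
case: c => // c /= lt_c.
have -> : (2 ^ w - 1) * c.+1 = (2 ^ w - 1 - c) + c * 2 ^ w.
  by rewrite mulnBl mul1n mulnS; lia.
rewrite HW_cat; first by rewrite addnC HW_complement.
by rewrite -subnDA ltn_subrL expn_gt0.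
Qed.

Lemma HW_all_ones (w : nat) : HW (2 ^ w - 1) = w.
Proof. by rewrite -[RHS](@HW_complement w 0) ?expn_gt0 // HW0 subn0. Qed.

Lemma HW_digits (K n : nat) (d : nat -> nat) :
  (forall i, i < n -> d i < 2 ^ K) ->
  HW (\sum_(i < n) d i * (2 ^ K) ^ i) = \sum_(i < n) HW (d i).
Proof.
elim: n => [|n IHn] d_lt; first by rewrite !big_ord0 HW0.
have d_ltS i : i < n -> d i < 2 ^ K by move/ltnW; apply: d_lt.
rewrite !big_ord_recr /= -expnM HW_cat ?IHn //.
by rewrite expnM; apply: digits_lt.
Qed.

(** Distinct places never collide, hence at most one summand feeds each base 2^K
    digit of the sum. *)
Lemma HW_family (I : finType) (pos : I -> nat) (d : I -> nat) (K : nat) :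
  injective pos -> (forall i, d i < 2 ^ K) ->
  HW (\sum_i d i * (2 ^ K) ^ pos i) = \sum_i HW (d i).
Proof.
move=> pos_inj d_lt; pose D j := \sum_(i | pos i == j) d i.
have D_one i : D (pos i) = d i.
  rewrite /D (big_pred1 i) // => i'; exact: inj_eq.
have D_none j : (forall i, pos i != j) -> D j = 0.
  by move=> nj; rewrite /D big_pred0 // => i; apply: negbTE.
rewrite (sum_by_position pos (2 ^ K)) (@HW_digits K _ D) => [|j _]; last first.
  case: (pickP (fun i => pos i == j)) => [i /eqP <-|no_j]; first by rewrite D_one.
  by rewrite D_none ?expn_gt0 // => i; rewrite no_j.
(* In base 1 the places disappear: this groups the weights in the same way. *)
have := sum_by_position pos 1 (fun i => HW (d i)).
under eq_bigr => i _ do rewrite exp1n muln1.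
move=> ->; apply: eq_bigr => j _; rewrite exp1n muln1.
case: (pickP (fun i => pos i == j)) => [i /eqP <-|no_j].
  by rewrite D_one (big_pred1 i) // => i'; apply: inj_eq.
by rewrite D_none ?HW0 ?big_pred0 // => i; rewrite no_j.
Qed.

(** * Hamming weight as a 2-adic valuation *)

(** Legendre's formula. Passing from N to 2N multiplies N! by the odd numbers up
    to 2N and by 2^N, while the Hamming weight does not change. *)
Lemma logn_fact_HW (N : nat) : logn 2 N`! + HW N = N.
Proof.
elim/ltn_ind: N => -[_|N IHN]; first by rewrite HW0 fact0 logn1.
have odd_logn b k : logn 2 ((b : bool) + k.*2)`! = logn 2 (k.*2)`!.
  case: b => //=; rewrite factS lognM ?fact_gt0 //.
  by rewrite logn_coprime // coprime2n /= odd_double.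
have logn_double k : logn 2 (k.*2)`! = k + logn 2 k`!.
  elim: k => // k IHk; rewrite doubleS !factS !lognM ?muln_gt0 ?fact_gt0 // IHk.
  rewrite (@logn_coprime 2 k.*2.+1) ?coprime2n /= ?odd_double //.
  by rewrite -doubleS -mul2n lognM // logn_prime // eqxx; lia.
set k := N.+1./2; have lt_kN : k < N.+1 by rewrite /k; lia.
rewrite -[N.+1]odd_double_half -/k HW_odd_double odd_logn logn_double.
have := IHN _ lt_kN; lia.
Qed.

(** Legendre's formula for 2N and twice for N: the valuation is
    (2N - HW N) - 2 (N - HW N). *)
Lemma logn_central_bin (N : nat) : logn 2 'C(N.*2, N) = HW N.
Proof.
have le_N2 : N <= N.*2 by rewrite -addnn leq_addr.
have /(congr1 (logn 2)) := bin_fact le_N2.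
rewrite -{2}addnn addnK !lognM ?muln_gt0 ?fact_gt0 ?bin_gt0 //.
have := logn_fact_HW N; have := logn_fact_HW N.*2.
rewrite (HW_odd_double false) add0n; lia.
Qed.

(** * Functions given by arithmetic terms *)

Definition arith (k : nat) (f : k.-tuple nat -> nat) : Prop :=
  exists T : aterm k, forall e, aeval e T = f e.

Section Arith.
Variable k : nat.
Implicit Types f g : k.-tuple nat -> nat.

Lemma eq_arith f g : f =1 g -> arith f -> arith g.
Proof. by move=> eq_fg [T DT]; exists T => e; rewrite DT. Qed.

Lemma arith_const c : arith (fun _ : k.-tuple nat => c).
Proof. by exists (AConst c). Qed.

Lemma arith_var (i : 'I_k) : arith (tnth (T := nat) ^~ i).
Proof. by exists (AVar i). Qed.

Lemma arithD f g : arith f -> arith g -> arith (fun e => f e + g e).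
Proof. by move=> [T DT] [U DU]; exists (AAdd T U) => e /=; rewrite DT DU. Qed.

Lemma arithB f g : arith f -> arith g -> arith (fun e => f e - g e).
Proof. by move=> [T DT] [U DU]; exists (AMonus T U) => e /=; rewrite DT DU. Qed.

Lemma arith_div f g : arith f -> arith g -> arith (fun e => f e %/ g e).
Proof. by move=> [T DT] [U DU]; exists (ADiv T U) => e /=; rewrite DT DU. Qed.

Lemma arithX f g : arith f -> arith g -> arith (fun e => f e ^ g e).
Proof. by move=> [T DT] [U DU]; exists (APow T U) => e /=; rewrite DT DU. Qed.

(** Polarization: 2 f g = (f + g)^2 - f^2 - g^2. *)
Lemma arithM f g : arith f -> arith g -> arith (fun e => f e * g e).
Proof.
move=> af ag; have a2 := arith_const 2.
have sq (h : k.-tuple nat -> nat) : arith h -> arith (fun e => h e ^ 2).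
  by move=> ah; exact: (arithX ah a2).
have: arith (fun e => ((f e + g e) ^ 2 - f e ^ 2 - g e ^ 2) %/ 2).
  by apply: arith_div => //; do !apply: arithB; apply: sq => //; apply: arithD.
apply: eq_arith => e; rewrite sqrnD -!addnA addKn addKn.
by rewrite mulKn.
Qed.

Lemma arith_mod f g : arith f -> arith g -> arith (fun e => f e %% g e).
Proof.
move=> af ag; have: arith (fun e => f e - f e %/ g e * g e).
  by apply: arithB => //; apply: arithM => //; apply: arith_div.
by apply: eq_arith => e; rewrite {1}(divn_eq (f e) (g e)) addKn.
Qed.

Lemma arithS f : arith f -> arith (fun e => (f e).+1).
Proof.
move=> af; have: arith (fun e => f e + 1) by apply: arithD => //; apply: arith_const.
by apply: eq_arith => e; rewrite addn1.
Qed.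

(** The binomial coefficients are the digits of (1 + B)^n in base B = 2^(n+1),
    since they are at most 2^n. *)
Lemma arith_bin f g : (forall e, g e <= f e) ->
  arith f -> arith g -> arith (fun e => 'C(f e, g e)).
Proof.
move=> le_gf af ag; pose B e := 2 ^ (f e).+1.
have aB : arith B by apply: (arithX (arith_const 2)); apply: arithS.
have: arith (fun e => (B e).+1 ^ f e %/ B e ^ g e %% B e).
  by apply: arith_mod => //; apply: arith_div; apply: arithX => //; apply: arithS.
apply: eq_arith => e.
rewrite -(@digit_extract (B e) (f e).+1 (g e) (fun i => 'C(f e, i))) ?ltnS //.
  rewrite -add1n expnDn; congr (_ %/ _ %% _).
  by apply: eq_bigr => i _; rewrite exp1n mul1n.
move=> i lt_i; rewrite /B expnS mul2n -addnn -addn1 leq_add ?expn_gt0 //.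
rewrite -[2]/(1 + 1) expnDn (bigD1 (Ordinal lt_i)) //= !exp1n !muln1.
exact: leq_addr.
Qed.

Lemma geometric_div (z n : nat) : 1 < z ->
  (z ^ n - 1) %/ (z - 1) = \sum_(i < n) z ^ i.
Proof. by move=> z_gt1; rewrite !subn1 predn_exp mulKn // -subn1 subn_gt0. Qed.

(** For a given i there is a suitable j exactly when b divides a i, that is when
    i is a multiple of b / gcd(a, b). Letting i run through 1, ..., b rather
    than 0, ..., b - 1 keeps the matching j in the range 0, ..., a - 1. *)
Lemma gcd_count (a b : nat) : 0 < a -> 0 < b ->
  #|[pred p : 'I_b * 'I_a | a * p.1.+1 + b * p.2 == a * b]| = gcdn a b.
Proof.
move=> a_gt0 b_gt0; set g := gcdn a b.
have g_gt0 : 0 < g by rewrite gcdn_gt0 a_gt0.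
rewrite -sum1_card -(pair_big_dep xpredT
  (fun (i : 'I_b) (j : 'I_a) => a * i.+1 + b * j == a * b) (fun _ _ => 1)) /=.
have Db : b = b %/ g * g by rewrite divnK ?dvdn_gcdr.
have Dbg : g = b %/ (b %/ g).
  by rewrite {1}Db mulKn // divn_gt0 // dvdn_leq // dvdn_gcdr.
rewrite [RHS]Dbg divn_count_dvd big_add1 big_mkord /=.
have dvd_ratio c : (b %/ g %| c) = (b %| a * c).
  rewrite {2}Db -[a](@divnK g) ?dvdn_gcdl // mulnAC dvdn_pmul2r // Gauss_dvdr //.
  rewrite coprime_sym /coprime -(eqn_pmul2r g_gt0) muln_gcdl mul1n.
  by rewrite !divnK ?dvdn_gcdl ?dvdn_gcdr.
apply: eq_bigr => i _; rewrite dvd_ratio.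
case: (boolP (b %| _)) => [/dvdnP[c Dc] | ndv].
  have c_gt0 : 0 < c by case: c Dc => //; rewrite mul0n; nia.
  have le_ca : c <= a by rewrite -(leq_pmul2r b_gt0) -Dc leq_pmul2l.
  have lt_ac : a - c < a by rewrite ltn_subrL c_gt0 a_gt0.
  rewrite (big_pred1 (Ordinal lt_ac)) // => j.
  rewrite Dc mulnC -mulnDr [a * b]mulnC eqn_pmul2l //.
  by rewrite -[RHS]val_eqE /=; lia.
rewrite big_pred0 // => j; apply: contraNF ndv => /eqP Dab.
by rewrite -(dvdn_addl _ (dvdn_mulr j (dvdnn b))) Dab dvdn_mull.
Qed.

(** The number of solutions in gcd_count is the coefficient of z^(ab) in
    z^a (1 + z^a + ... + z^(a(b-1))) (1 + z^b + ... + z^(b(a-1))). Both sums have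
    a closed form, and z = 2^(ab) exceeds the number ab of pairs (i, j), so this
    coefficient is a digit in base z. *)
Lemma arith_gcd f g : (forall e, 0 < f e) -> (forall e, 0 < g e) ->
  arith f -> arith g -> arith (fun e => gcdn (f e) (g e)).
Proof.
move=> f_gt0 g_gt0 af ag; have a1 := @arith_const 1; have a2 := @arith_const 2.
pose z e := 2 ^ (f e * g e).
have az : arith z by apply: (arithX a2); apply: arithM.
have ageo (h h' : k.-tuple nat -> nat) : arith h -> arith h' ->
    arith (fun e => ((z e ^ h e) ^ h' e - 1) %/ (z e ^ h e - 1)).
  by move=> ah ah'; apply: arith_div; apply: arithB => //; do ?apply: arithX => //.
have: arith (fun e => z e ^ f e *
   (((z e ^ f e) ^ g e - 1) %/ (z e ^ f e - 1) *
    (((z e ^ g e) ^ f e - 1) %/ (z e ^ g e - 1))) %/ z e ^ (f e * g e) %% z e).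
  apply: arith_mod => //; apply: arith_div; last by apply: arithX => //; apply: arithM.
  by apply: arithM; [apply: arithX | apply: arithM; apply: ageo].
apply: eq_arith => e; rewrite /z {z az ageo}.
move: (f e) (g e) (f_gt0 e) (g_gt0 e) => a b a_gt0 b_gt0.
set z := 2 ^ (a * b); have ab_gt0 : 0 < a * b by rewrite muln_gt0 a_gt0.
have z_gt1 : 1 < z by rewrite -(expn0 2) ltn_exp2l.
have zX_gt1 c : 0 < c -> 1 < z ^ c by move=> c_gt0; rewrite -(exp1n c) ltn_exp2r.
rewrite !geometric_div ?zX_gt1 // -gcd_count //.
rewrite -(@count_by_digit _ (fun p : 'I_b * 'I_a => a * p.1.+1 + b * p.2) z); last first.
  by rewrite card_prod !card_ord mulnC ltn_expl.
congr (_ %/ _ %% _); rewrite big_distrlr pair_big big_distrr /=.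
by apply: eq_bigr => p _; rewrite mulnS -addnA !expnD -!expnM.
Qed.

(** Set y = 2^K - 1. Then (2^v)^K = (1 + y)^v is congruent to 1 + v y modulo y^2,
    and K = g + 2 makes 1 + v y smaller than y^2. *)
Lemma arith_log2 f g : (forall e, f e <= g e) ->
  arith g -> arith (fun e => 2 ^ f e) -> arith f.
Proof.
move=> le_fg ag a2f; have a1 := @arith_const 1; have a2 := @arith_const 2.
pose K e := g e + 2; pose y e := 2 ^ K e - 1.
have aK : arith K by apply: arithD.
have ay : arith y by apply: arithB => //; apply: arithX.
have: arith (fun e => ((2 ^ f e) ^ K e %% (y e * y e) - 1) %/ y e).
  apply: arith_div => //; apply: arithB => //.
  by apply: arith_mod; [apply: arithX | apply: arithM].
apply: eq_arith => e; rewrite /y /K {y K aK ay}.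
move: (f e) (g e) (le_fg e) => v n le_vn.
set y := 2 ^ (n + 2) - 1; have lt_vy : v + 2 < y.
  by rewrite /y expnD -[2 ^ 2]/4; have := ltn_expl n (ltnSn 1); lia.
have Dy : 2 ^ (n + 2) = y.+1 by rewrite /y subn1 prednK ?expn_gt0.
have -> : (2 ^ v) ^ (n + 2) = v * y + 1 %[mod y * y].
  rewrite -expnM mulnC expnM Dy; elim: v {le_vn lt_vy} => // v IHv.
  rewrite expnS -modnMmr IHv modnMmr -[RHS](modnMDl v).
  by congr (_ %% _); ring.
rewrite modn_small; last by nia.
by rewrite addnK mulnK //; lia.
Qed.

End Arith.

Lemma gcdn_pow2_logn (a K : nat) : 0 < a -> logn 2 a <= K ->
  gcdn a (2 ^ K) = 2 ^ logn 2 a.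
Proof.
move=> a_gt0 le_aK; have [u co_2u Da] := pfactor_coprime (isT : prime 2) a_gt0.
rewrite {1}Da -{1}(subnK le_aK) expnD -muln_gcdl.
have /eqP -> : coprime u (2 ^ (K - logn 2 a)) by rewrite coprime_sym coprimeXl.
exact: mul1n.
Qed.

Lemma HW_le (N : nat) : HW N <= N.
Proof. by have := logn_fact_HW N; lia. Qed.

(** HW N is the exponent of 2 in the binomial coefficient (2N choose N), and the
    corresponding power of 2 is the gcd of this coefficient with 2^N. *)
Lemma arith_HW : arith (fun e : 1.-tuple nat => HW (tnth e ord0)).
Proof.
have aN := @arith_var 1 ord0; have a2 := @arith_const 1 2.
apply: (arith_log2 (fun e => HW_le (tnth e ord0))) => //.
pose B (e : 1.-tuple nat) := 'C((tnth e ord0).*2, tnth e ord0).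
have B_gt0 e : 0 < B e by rewrite bin_gt0 -addnn leq_addr.
have aB : arith B.
  apply: arith_bin => // [e|]; first by rewrite -addnn leq_addr.
  by apply: eq_arith (arithD aN aN) => e; rewrite addnn.
have: arith (fun e => gcdn (B e) (2 ^ tnth e ord0)).
  by apply: arith_gcd => // [e|]; [rewrite expn_gt0 | apply: arithX].
apply: eq_arith => e; rewrite gcdn_pow2_logn ?logn_central_bin //.
exact: HW_le.
Qed.

Import Order.TTheory GRing.Theory Num.Theory.
Local Open Scope ring_scope.

(** * Integer-valued functions given by arithmetic terms *)

(** Subtraction of terms is truncated, so a signed quantity is represented by a
    difference of two terms; this class is closed under the ring operations. *)
Definition arithz (k : nat) (f : k.-tuple nat -> int) : Prop :=
  exists P Q : k.-tuple nat -> nat,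
    [/\ arith P, arith Q & forall e, f e = (P e)%:Z - (Q e)%:Z].

Section Arithz.
Variable k : nat.
Implicit Types f g : k.-tuple nat -> int.

Lemma eq_arithz f g : f =1 g -> arithz f -> arithz g.
Proof.
by move=> eq_fg [P [Q [aP aQ Df]]]; exists P, Q; split=> // e; rewrite -eq_fg.
Qed.

Lemma arithz_nat (h : k.-tuple nat -> nat) : arith h -> arithz (fun e => (h e)%:Z).
Proof.
move=> ah; exists h, (fun=> 0%N); split=> // [|e]; first exact: arith_const.
by rewrite subr0.
Qed.

Lemma arith_of_arithz f (h : k.-tuple nat -> nat) :
  arithz f -> (forall e, f e = (h e)%:Z) -> arith h.
Proof.
move=> [P [Q [aP aQ Df]]] Dh; apply: eq_arith (arithB aP aQ) => e.
by have := Df e; rewrite Dh; lia.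
Qed.

Lemma arithzD f g : arithz f -> arithz g -> arithz (fun e => f e + g e).
Proof.
move=> [P [Q [aP aQ Df]]] [P' [Q' [aP' aQ' Dg]]].
exists (fun e => P e + P' e)%N, (fun e => Q e + Q' e)%N.
by split=> [||e]; [exact: arithD | exact: arithD | rewrite Df Dg; lia].
Qed.

Lemma arithzN f : arithz f -> arithz (fun e => - f e).
Proof.
by move=> [P [Q [aP aQ Df]]]; exists Q, P; split=> // e; rewrite Df opprB.
Qed.

Lemma arithzM f g : arithz f -> arithz g -> arithz (fun e => f e * g e).
Proof.
move=> [P [Q [aP aQ Df]]] [P' [Q' [aP' aQ' Dg]]].
exists (fun e => P e * P' e + Q e * Q' e)%N, (fun e => P e * Q' e + Q e * P' e)%N.
by split=> [||e]; [apply: arithD; exact: arithM | apply: arithD; exact: arithM |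
  rewrite Df Dg !PoszD !PoszM; ring].
Qed.

Lemma arithz_const (c : int) : arithz (fun _ : k.-tuple nat => c).
Proof.
case: c => c; first by apply: arithz_nat; apply: arith_const.
by rewrite NegzE; apply: arithzN; apply: arithz_nat; apply: arith_const.
Qed.

Lemma arithz_exp f (r : nat) : arithz f -> arithz (fun e => f e ^+ r).
Proof.
move=> af; elim: r => [|r IHr]; first exact: arithz_const.
by apply: eq_arithz (arithzM af IHr) => e; rewrite exprS.
Qed.

Lemma arithz_sum (I : Type) (s : seq I) (F : I -> k.-tuple nat -> int) :
  (forall i, arithz (F i)) -> arithz (fun e => \sum_(i <- s) F i e).
Proof.
move=> aF; elim: s => [|i s IHs].
  by apply: eq_arithz (arithz_const 0) => e; rewrite big_nil.
by apply: eq_arithz (arithzD (aF i) IHs) => e; rewrite big_cons.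
Qed.

Lemma arithz_prod (I : Type) (s : seq I) (F : I -> k.-tuple nat -> int) :
  (forall i, arithz (F i)) -> arithz (fun e => \prod_(i <- s) F i e).
Proof.
move=> aF; elim: s => [|i s IHs].
  by apply: eq_arithz (arithz_const 1) => e; rewrite big_nil.
by apply: eq_arithz (arithzM (aF i) IHs) => e; rewrite big_cons.
Qed.

End Arithz.

(** Replacing j by j + 1 in G r q s gives on the one hand the same sum up to its
    end terms, and on the other hand, after expanding (j + 1)^r, a combination
    of the sums G l q s with l <= r. *)
Lemma G_rec (r : nat) (q : int) (s : nat) :
  (q - 1) * G r q s =
  s.+1%:Z ^+ r * q ^+ s.+1 - 0 ^+ r
    - q * \sum_(l < r) 'C(r, l)%:Z * G l q s.
Proof.
pose T := \sum_(0 <= j < s.+1) (j.+1)%:Z ^+ r * q ^+ j.+1.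
have T_shift : T = G r q s + s.+1%:Z ^+ r * q ^+ s.+1 - 0 ^+ r.
  pose a j := j%:Z ^+ r * q ^+ j.
  have : \sum_(0 <= j < s.+2) a j = \sum_(0 <= j < s.+2) a j by [].
  rewrite [LHS]big_nat_recl // [RHS]big_nat_recr //= -/T -/(G r q s) /a expr0 mulr1.
  by move=> <-; ring.
have T_bin : T = q * (\sum_(l < r) 'C(r, l)%:Z * G l q s + G r q s).
  have -> : \sum_(l < r) 'C(r, l)%:Z * G l q s + G r q s =
            \sum_(l < r.+1) 'C(r, l)%:Z * G l q s.
    by rewrite big_ord_recr /= binn mul1r.
  rewrite mulr_sumr /T /G.
  under [RHS]eq_bigr => l _ do rewrite !mulr_sumr.
  rewrite exchange_big /=; apply: eq_bigr => j _.
  rewrite exprS -addn1 PoszD addrC exprDn mulrCA mulr_suml mulr_sumr.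
  apply: eq_bigr => l _; rewrite expr1n mul1r -mulr_natl natz; ring.
have := etrans (esym T_shift) T_bin; rewrite mulrDr mulrBl mul1r.
by move=> /eqP; rewrite -subr_eq => /eqP <-; ring.
Qed.

Lemma G_ge0 (r q s : nat) : 0 <= G r q%:Z s.
Proof. by apply: sumr_ge0 => j _; rewrite mulr_ge0 ?exprn_ge0. Qed.

Section ArithG.
Variable k : nat.
Implicit Types q s : k.-tuple nat -> nat.

(** By induction on r, the recurrence expresses (q - 1) G r q s; this is a natural
    number divisible by q - 1, so one floor division recovers G r q s. *)
Lemma arithz_G (r : nat) q s : (forall e, 1 < q e)%N ->
  arith q -> arith s -> arithz (fun e => G r (q e)%:Z (s e)).
Proof.
move=> q_gt1 aq asx; elim/ltn_ind: r => r IHr.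
pose h e := `|G r (q e)%:Z (s e)|%N.
have Dh e : G r (q e)%:Z (s e) = (h e)%:Z by rewrite /h gez0_abs ?G_ge0.
suff ah : arith h by apply: eq_arithz (arithz_nat ah) => e; rewrite Dh.
have aqh : arith (fun e => (q e - 1) * h e)%N.
  have aS := arithS asx.
  have asum : arithz (fun e => \sum_(l < r) 'C(r, l)%:Z * G l (q e)%:Z (s e)).
    by apply: arithz_sum => l; apply: arithzM (IHr _ _) => //; apply: arithz_const.
  have aT := arithzM (arithz_exp r (arithz_nat aS)) (arithz_nat (arithX aq aS)).
  (* The right-hand side of the recurrence. *)
  have := arithzD (arithzD aT (arithzN (arithz_const k (0 ^+ r))))
                  (arithzN (arithzM (arithz_nat aq) asum)).
  move/arith_of_arithz; apply=> e.
  by rewrite PoszM -Dh -subzn ?(ltnW (q_gt1 e)) // G_rec -!natz !natrX.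
apply: eq_arith (arith_div aqh (arithB aq (arith_const k 1))) => e.
by rewrite mulKn // subn_gt0.
Qed.

End ArithG.

(** * An arithmetic term for M *)

Section ArithM.
Variable k : nat.
Implicit Types t w : k.-tuple nat -> nat.

Lemma arith_weight t w c :
  arith t -> arith w -> arith (fun e => 2 ^ (2 * w e * t e ^ c))%N.
Proof.
move=> at_ aw; apply: (arithX (arith_const k 2)).
apply: arithM; first exact: (arithM (arith_const k 2)).
exact: (arithX at_ (arith_const k c)).
Qed.

Lemma arithz_pow2 w : arith w -> arithz (fun e => 2 ^+ w e : int).
Proof.
move=> aw; apply: eq_arithz (arithz_nat (arithX (arith_const k 2) aw)) => e.
by rewrite -[RHS]natrX natz.
Qed.

Lemma arithz_calA t w (l : nat) (alpha : k.-tuple nat -> int) (g : l.-tuple nat) :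
  (forall e, 0 < t e)%N -> (forall e, 0 < w e)%N ->
  arith t -> arith w -> arithz alpha ->
  arithz (fun e => calA (t e) (w e) (pmonomial (alpha e) g)).
Proof.
move=> t_gt0 w_gt0 at_ aw aal.
have aw1 : arithz (fun e => - (2 ^+ w e - 1)).
  by apply/arithzN/(arithzD (arithz_pow2 aw))/arithzN/arithz_const.
apply: arithzM; first exact: arithzM.
apply: arithz_prod => i.
have q_gt1 e : (1 < 2 ^ (2 * w e * t e ^ i))%N.
  by rewrite -{1}(expn0 2) ltn_exp2l // !muln_gt0 w_gt0 expn_gt0 t_gt0.
have at1 : arith (fun e => (t e).-1).
  by apply: eq_arith (arithB at_ (arith_const k 1)) => e; rewrite subn1.
have := arithz_G (tnth g i) q_gt1 (arith_weight i at_ aw) at1.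
apply: eq_arithz => e; congr (G _ _ _).
by rewrite /= mulr1 -[RHS]natrX natz.
Qed.

Lemma arithz_calC t w (eps : int) (l : nat) :
  arith t -> arith w -> arithz (fun e => calC (t e) (w e) eps l).
Proof.
move=> at_ aw; apply: arithzM.
  by do 2?apply: arithzD; [exact: arithz_pow2 | exact: arithz_const..].
have aW := arithX (arith_const k 2) aw; have a1 := arith_const k 1.
have aq := arith_div (arithB (arith_weight l at_ aw) a1) (arithD aW a1).
apply: eq_arithz (arithz_nat aq) => e.
by rewrite -divz_nat -subzn ?expn_gt0 // PoszD -!natz !natrX.
Qed.

End ArithM.

Lemma arithz_M :
  arithz (fun e : 2.-tuple nat => M (tnth e ord0) (tnth e (lift ord0 ord0))).
Proof.
have am := arith_var (ord0 : 'I_2); have an := arith_var (lift ord0 ord0 : 'I_2).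
have at_ := arithS an; have aw := arithD an (arith_const 2 5).
have A (alpha : 2.-tuple nat -> int) (g : 4.-tuple nat) : arithz alpha ->
  arithz (fun e => let n := tnth e (lift ord0 ord0) in
                   calA n.+1 (n + 5) (pmonomial (alpha e) g)).
  by apply: arithz_calA => // e; rewrite addn_gt0 orbT.
have az := arithz_nat am; have nz := arithz_nat an.
rewrite /M; repeat first
  [ exact: arithz_const | exact: az | exact: nz | apply: A | apply: arithz_calC
  | apply: arithz_exp | apply: arithzM | apply: arithzD ] => //.
Qed.

(** * The base 2^(2w) digits of M *)

(** The product telescopes: (q^(t^i) - 1) * sum_j (q^(t^i))^j = q^(t^(i+1)) - 1. *)
Lemma prod_geometric (q : int) (t k : nat) :
  (q - 1) * \prod_(i < k) \sum_(j < t) (q ^+ (t ^ i)) ^+ j = q ^+ (t ^ k) - 1.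
Proof.
elim: k => [|k IHk]; first by rewrite big_ord0 mulr1.
by rewrite big_ord_recr /= mulrA IHk -subrX1 -exprM expnS mulnC.
Qed.

Definition monomial_value (k t : nat) (g : k.-tuple nat)
    (f : {ffun 'I_k -> 'I_t}) : int :=
  \prod_(i < k) (f i)%:Z ^+ tnth g i.

(** Distributing the product of the sums G over a choice f of one index in each
    factor produces the monomial evaluated at f, at the place of f. *)
Lemma calA_sum (t w k : nat) (alpha : int) (g : k.-tuple nat) :
  (0 < t)%N ->
  calA t w (pmonomial alpha g) =
  \sum_(f : {ffun 'I_k -> 'I_t})
    (- (2 ^+ w - 1) * (alpha * monomial_value g f)) * (2 ^+ (2 * w)) ^+ place f.
Proof.
move=> t_gt0; rewrite /calA /= /G prednK //.
under eq_bigr => i _ do rewrite big_mkord.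
rewrite bigA_distr_bigA mulr_sumr; apply: eq_bigr => f _.
rewrite big_split /= -/(monomial_value g f) !mulrA; congr (_ * _).
rewrite /place expr_sum; apply: eq_bigr => i _.
by rewrite mulr1 -!exprM mulnAC mulnA.
Qed.

(** Since 2^(2w) - 1 = (2^w - 1) (2^w + 1), the quotient in C is 2^w - 1 times a
    number with digit 1 at every place. *)
Lemma calC_sum (t w k : nat) (eps : int) :
  calC t w eps k =
  \sum_(f : {ffun 'I_k -> 'I_t})
    ((2 ^+ w - eps + 1) * (2 ^+ w - 1)) * (2 ^+ (2 * w)) ^+ place f.
Proof.
have w1_neq0 : 2 ^+ w + 1 != 0 :> int by rewrite lt0r_neq0 // ltr_wpDl ?exprn_ge0.
rewrite /calC exprM -prod_geometric bigA_distr_bigA /=.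
have -> : (2 ^+ (2 * w) - 1 : int) = (2 ^+ w + 1) * (2 ^+ w - 1).
  by rewrite mulnC exprM; ring.
rewrite -mulrA mulKz // mulrA mulr_sumr; apply: eq_bigr => f _.
congr (_ * _); rewrite /place expr_sum; apply: eq_bigr => i _.
by rewrite -exprM [(t ^ i * _)%N]mulnC.
Qed.

(** A sum of two squares, so that it vanishes exactly when both
    m x1 = n x2 + 1 and x1 = x3 + x4 + 1 hold; x1, ..., x4 have the indices
    0, ..., 3. *)
Definition inv_poly (m n : nat) (f : {ffun 'I_4 -> 'I_n.+1}) : int :=
  let x i := (f (inord i))%:Z in
  (m%:Z * x 0%N - n%:Z * x 1%N - 1) ^+ 2 + (x 0%N - x 2%N - x 3%N - 1) ^+ 2.

(** Collecting the twelve monomials and the constant 2 gives the expansion of the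
    two squares; the point x has the digit (2^w - 1) (2^w + 1 - P(x)). *)
Lemma M_sum (m n : nat) :
  M m n = \sum_(f : {ffun 'I_4 -> 'I_n.+1})
    ((2 ^+ (n + 5) - 1) * (2 ^+ (n + 5) + 1 - inv_poly m f)) *
    (2 ^+ (2 * (n + 5))) ^+ place f.
Proof.
rewrite /M calC_sum !calA_sum // -!big_split /=; apply: eq_bigr => f _.
rewrite -!mulrDl; congr (_ * _).
rewrite /inv_poly /monomial_value !big_ord_recl !big_ord0 !(tnth_nth 0%N) /= /bump /=.
have -> : ord0 = inord 0 :> 'I_4 by apply: val_inj; rewrite /= inordK.
have -> : lift (inord 0) ord0 = inord 1 :> 'I_4 by apply: val_inj; rewrite /= !inordK.
have -> : lift (inord 0) (lift ord0 ord0) = inord 2 :> 'I_4.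
  by apply: val_inj; rewrite /= !inordK.
have -> : lift (inord 0) (lift ord0 (lift ord0 ord0)) = inord 3 :> 'I_4.
  by apply: val_inj; rewrite /= !inordK.
move: (f _) (f _) (f _) (f _) (2 ^+ (n + 5)) => x1 x2 x3 x4 W.
ring.
Qed.

(** * The zeros of the encoded polynomial *)

(** On the cube the two bases of the squares are at most n^2 + 1 and 2n + 1 in
    absolute value. This bound is what makes w = n + 5 large enough. For n >= 5
    the left side at most doubles when n grows by one, and the smaller n are
    checked by computation. *)
Lemma quartic_le_pow2 (n : nat) : (2 <= n)%N ->
  ((n * n + 1) ^ 2 + (2 * n + 1) ^ 2 <= 2 ^ (n + 5))%N.
Proof.
have base : ((5 * 5 + 1) ^ 2 + (2 * 5 + 1) ^ 2 <= 2 ^ (5 + 5))%N by [].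
case: (leqP n 4) => [|n_gt4 _].
  by case: n => [|[|[|[|[|n]]]]].
elim: n n_gt4 => // n IHn; rewrite ltnS leq_eqVlt => /orP[/eqP <- //|n_gt4].
rewrite addSn [(2 ^ (n + 5).+1)%N]expnS; apply: leq_trans (leq_mul (leqnn 2) (IHn n_gt4)).
have [k ->] : exists k, n = (k + 5)%N by exists (n - 5)%N; rewrite subnK.
rewrite !expnS expn0 !muln1.
nia.
Qed.

Lemma inv_poly_ge0 (m n : nat) f : 0 <= @inv_poly m n f.
Proof. by rewrite addr_ge0 // sqr_ge0. Qed.

Lemma sqr_le_nat (z : int) (b : nat) : - b%:Z <= z <= b%:Z -> z ^+ 2 <= (b ^ 2)%:Z.
Proof. by move=> /andP[z_ge z_le]; rewrite expr2 expnS expn1 PoszM; nia. Qed.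

Lemma inv_poly_le (m n : nat) f : (2 <= n)%N -> (1 <= m <= n - 1)%N ->
  @inv_poly m n f <= 2 ^+ (n + 5).
Proof.
move=> n_ge2 m_int.
have -> : 2 ^+ (n + 5) = (2 ^ (n + 5))%N%:Z :> int by rewrite -!natz natrX.
apply: le_trans (_ : ((n * n + 1) ^ 2 + (2 * n + 1) ^ 2)%N%:Z <= _); last first.
  by rewrite lez_nat quartic_le_pow2.
rewrite /inv_poly /= PoszD.
have xP i : (f i <= n)%N by rewrite -ltnS.
have [x1 x2 x3 x4] := And4 (xP (inord 0)) (xP (inord 1)) (xP (inord 2)) (xP (inord 3)).
apply: lerD; apply: sqr_le_nat; apply/andP; split; try nia; lia.
Qed.

(** The first equation reads m x1 = 1 modulo n, which determines x1 in the range
    0, ..., n: the extreme values 0 and n are excluded because n >= 2. It then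
    determines x2 as well. *)
Lemma inv_poly_eq0 (m n : nat) (f : {ffun 'I_4 -> 'I_n.+1}) :
  (2 <= n)%N -> (1 <= m <= n - 1)%N -> coprime m n ->
  (inv_poly m f == 0) =
  [&& f (inord 0) == modinv m n :> nat,
      f (inord 1) == ((m * modinv m n) %/ n)%N :> nat &
      (f (inord 2) + f (inord 3) == modinv m n - 1)%N].
Proof.
move=> n_ge2 m_int co_mn; have [inv_int inv1] := modinv_spec n_ge2 co_mn.
rewrite /inv_poly /= paddr_eq0 ?sqr_ge0 // !sqrf_eq0.
have x1_le : (f (inord 0) <= n)%N by rewrite -ltnS.
move: (f _ : nat) (f _ : nat) (f _ : nat) (f _ : nat) x1_le => x4 x3 x2 x1 x1_le.
have mq : (m * modinv m n = m * modinv m n %/ n * n + 1)%N.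
  by rewrite {1}(divn_eq (m * modinv m n) n) inv1 (modn_small n_ge2).
apply/andP/and3P => [[/eqP E1 /eqP E2] | [/eqP E1 /eqP E2 /eqP E3]].
  have E1' : (m * x1 = x2 * n + 1)%N by lia.
  have Dx1 : x1 = modinv m n.
    apply: modinv_uniq => //; last by rewrite E1' modnMDl.
    apply/andP; split; first by case: (x1) E1' => //; rewrite muln0 addn1.
    suff : x1 != n by lia.
    apply/eqP => Dx; move: E1'; rewrite Dx => /(congr1 (modn^~ n)).
    by rewrite modnMl modnMDl modn_small.
  split; first by rewrite Dx1.
    by rewrite -Dx1 E1' divnMDl ?divn_small ?addn0 //; lia.
  by apply/eqP; lia.
by rewrite E1 E2; split; apply/eqP; lia.
Qed.

(** Only x3 remains free, with the values 0, ..., inv(m, n) - 1. *)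
Lemma card_inv_poly_eq0 (m n : nat) :
  (2 <= n)%N -> (1 <= m <= n - 1)%N -> coprime m n ->
  #|[pred f : {ffun 'I_4 -> 'I_n.+1} | inv_poly m f == 0]| = modinv m n.
Proof.
move=> n_ge2 m_int co_mn; have [v_int _] := modinv_spec n_ge2 co_mn.
have zeroP := @inv_poly_eq0 m n _ n_ge2 m_int co_mn.
set v := modinv m n in v_int zeroP *.
have q_le : (m * v %/ n <= n)%N
  by rewrite -[leqRHS](mulKn n (ltnW n_ge2)) leq_div2r // leq_mul //; lia.
pose sol (j : 'I_v) : {ffun 'I_4 -> 'I_n.+1} :=
  [ffun i : 'I_4 => inord (nth 0 [:: v; (m * v %/ n); j : nat; v - 1 - j] i)%N].
have solE (j : 'I_v) (i : nat) (lt_i : (i < 4)%N) :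
    sol j (inord i : 'I_4)
      = nth 0%N [:: v; (m * v %/ n)%N; j : nat; (v - 1 - j)%N] i :> nat.
  rewrite ffunE !inordK //; have := ltn_ord j.
  by case: i lt_i => [|[|[|[|i]]]] //=; lia.
have sol_inj : injective sol.
  move=> j j' eq_sol; apply: val_inj.
  by have := solE j 2%N isT; rewrite eq_sol solE.
rewrite -[RHS]card_ord -(card_imset _ sol_inj); apply: eq_card => f.
rewrite inE zeroP; apply/and3P/imsetP => [[/eqP f0 /eqP f1 /eqP f23] | [j _ ->]].
  have lt_f2 : (f (inord 2) < v)%N.
    by rewrite (leq_ltn_trans (leq_addr (f (inord 3)) _)) // f23; lia.
  exists (Ordinal lt_f2) => //; apply/ffunP => i; apply: val_inj.
  rewrite /= -(inord_val i) solE ?ltn_ord //=.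
  by case: i => [[|[|[|[|i]]]] lt_i] //=; lia.
by rewrite !solE //=; split=> //; apply/eqP; have := ltn_ord j; lia.
Qed.

(** A zero of P contributes a digit 2^(2w) - 1 of weight 2w; any other point
    contributes a multiple of 2^w - 1 by a factor between 1 and 2^w, of weight w. *)
Lemma HW_M (m n : nat) :
  (2 <= n)%N -> (1 <= m <= n - 1)%N -> coprime m n ->
  0 <= M m n /\ HW `|M m n|%N = ((n + 5) * (n.+1 ^ 4 + modinv m n))%N.
Proof.
move=> n_ge2 m_int co_mn; set w := (n + 5)%N.
pose c (f : {ffun 'I_4 -> 'I_n.+1}) := (2 ^ w + 1 - `|inv_poly m f|)%N.
pose d f := ((2 ^ w - 1) * c f)%N.
have posXz a b : (a ^ b)%N%:Z = a%:Z ^+ b by rewrite -!natz natrX.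
have abs_le (f : {ffun 'I_4 -> 'I_n.+1}) : (`|inv_poly m f| <= 2 ^ w)%N.
  by rewrite -lez_nat gez0_abs ?inv_poly_ge0 // posXz; apply: inv_poly_le.
have M_nat : M m n = (\sum_f d f * (2 ^ (2 * w)) ^ place f)%N%:Z.
  rewrite M_sum -natz natr_sum; apply: eq_bigr => f _.
  rewrite natrM !natrX natz !natz /d PoszM; congr (_ * _ * _).
    by rewrite -subzn ?expn_gt0 // posXz.
  rewrite /c -subzn; last by rewrite (leq_trans (abs_le f)) ?leq_addr.
  by rewrite PoszD posXz gez0_abs ?inv_poly_ge0.
rewrite M_nat absz_nat; split=> //.
have d_lt f : (d f < 2 ^ (2 * w))%N.
  have := expn_gt0 2 w; rewrite /d /c mulnC [(2 * w)%N]mulnC expnM => /= w_gt0.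
  have : (2 ^ w + 1 - `|inv_poly m f| <= 2 ^ w + 1)%N by apply: leq_subr.
  rewrite expnS expn1; nia.
rewrite HW_family //; last exact: place_inj.
have HW_d f : HW (d f) = (w + (inv_poly m f == 0%R) * w)%N.
  rewrite /d /c; case: eqP => [-> | /eqP nz].
    rewrite absz0 subn0 mul1n addnn -mul2n -[RHS](HW_all_ones (2 * w)).
    congr HW; rewrite mulnC [(2 * w)%N]mulnC expnM.
    by rewrite -[1%N in RHS](exp1n 2) subn_sqr mulnC.
  rewrite mul0n addn0 HW_mul_pred_expn //.
  have : `|inv_poly m f|%N != 0%N by rewrite absz_eq0.
  by have := abs_le f; lia.
under eq_bigr => f _ do rewrite HW_d.
rewrite big_split -big_distrl /= sum_nat_const card_ffun !card_ord.
rewrite -(card_inv_poly_eq0 n_ge2 m_int co_mn) -sum1_card -mulnDl mulnC.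
congr (_ * (_ + _))%N; rewrite [RHS]big_mkcond /=.
by apply: eq_bigr => f _; rewrite inE; case: eqP.
Qed.

Theorem theorem7p3 :
  exists (HWt : aterm 1) (Mt : aterm 2),
    (forall N : nat, aeval [tuple N] HWt = HW N) /\
    forall m n : nat,
      (2 <= n)%N -> (1 <= m <= n - 1)%N -> coprime m n ->
      [/\ (aeval [tuple m; n] Mt)%:Z = M m n,
          (modinv m n)%:R
            = (HW `|M m n|%N)%:R / (n + 5)%:R - (n + 1)%:R ^+ 4 :> rat &
          modinv m n = aeval [tuple m; n] (modinv_term HWt Mt)].
Proof.
have [HWt HWtE] := arith_HW; have [P [Q [[TP TPE] [TQ TQE] DM]]] := arithz_M.
exists HWt, (AMonus TP TQ); split=> [N | m n n_ge2 m_int co_mn].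
  by rewrite HWtE.
have [M_ge0 HW_ME] := HW_M n_ge2 m_int co_mn.
have Mt_E : (aeval [tuple m; n] (AMonus TP TQ))%:Z = M m n.
  have := DM [tuple m; n]; rewrite /= TPE TQE !(tnth_nth 0%N) /= => E.
  by move: M_ge0; rewrite E; lia.
have asubstE (T : aterm 1) (U : aterm 2) e :
    aeval e (asubst (fun=> U) T) = aeval [tuple aeval e U] T.
  by elim: T => //= [i | ? -> ? -> | ? -> ? -> | ? -> ? -> | ? -> ? ->]; rewrite ?ord1.
split=> //.
  have w_neq0 : (n + 5)%:R != 0 :> rat by rewrite pnatr_eq0 addn_eq0 andbF.
  rewrite HW_ME natrM mulrAC divff // mul1r.
  by rewrite natrD -natrX addn1 addrAC subrr add0r.
have HW_Mt : HW (aeval [tuple m; n] (AMonus TP TQ)) = HW `|M m n| by rewrite -Mt_E.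
rewrite /modinv_term; move: (AMonus TP TQ) HW_Mt => Mt HW_Mt.
rewrite /= asubstE HWtE !(tnth_nth 0%N) /= HW_Mt HW_ME mulKn ?addn_gt0 ?orbT //.
by rewrite addn1 addKn.
Qed.
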